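(* (a) Suppose $X$ and $Y$ are Banach spaces. Then the following are equivalent: (1) both $X$ and $Y$ are subprojective; (2) $X \oplus Y$ is subprojective. (b) Suppose $X_1, X_2, \ldots$ are Banach spaces, and $\mathcal{E}$ is a space with a $1$-unconditional basis. Then the following are equivalent: (1) the spaces $\mathcal{E}, X_1, X_2, \ldots$ are all subprojective; (2) the space $(\sum_n X_n)_{\mathcal{E}}$ is subprojective.
   Context: All Banach spaces are assumed infinite dimensional, and ''subspace'' means closed infinite dimensional subspace. A Banach space $X$ is subprojective if every subspace $Y \subset X$ contains a further subspace $Z \subset Y$ that is complemented in $X$ (i.e. is the range of a bounded linear projection on $X$). In (b), $\mathcal{E}$ is a Banach space with a $1$-unconditional basis, viewed (via coordinates with respect to this basis) as a space of scalar sequences with norm $\|\cdot\|_{\mathcal{E}}$. The space $(\sum_n X_n)_{\mathcal{E}}$ is the space of all sequences $(x_n)_{n\in\mathbb{N}} \in \prod_{n} X_n$ with $(\|x_n\|_{X_n})_n \in \mathcal{E}$, equipped with the norm $\|(x_n)_n\| = \|(\|x_n\|_{X_n})_n\|_{\mathcal{E}}$; it is a Banach space. *)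

(* Defs.v *)
From HB Require Import structures.
From mathcomp Require Import all_boot all_order all_algebra.
From mathcomp Require Import all_classical all_reals all_analysis.

Set Implicit Arguments.
Unset Strict Implicit.
Unset Printing Implicit Defensive.

Import Order.TTheory GRing.Theory Num.Theory.
Import numFieldNormedType.Exports.

Local Open Scope classical_set_scope.
Local Open Scope ring_scope.

Section Subprojective.
Context {K : numFieldType}.

Definition linear_subspace (V : lmodType K) (A : set V) : Prop :=
  A 0 /\ forall (c : K) (x y : V), A x -> A y -> A (c *: x + y).

Definition finite_dimensional (V : lmodType K) (A : set V) : Prop :=
  exists (n : nat) (v : 'I_n -> V),
    (forall i, A (v i)) /\
    forall x, A x -> exists c : 'I_n -> K, x = \sum_(i < n) c i *: v i.

Definition infinite_dimensional (V : lmodType K) : Prop :=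
  ~ finite_dimensional [set: V].

Definition subspace (V : normedModType K) (A : set V) : Prop :=
  [/\ linear_subspace A, closed A & ~ finite_dimensional A].

Definition complemented (V : normedModType K) (A : set V) : Prop :=
  exists P : {linear V -> V},
    [/\ exists M : K, forall x, `|P x| <= M * `|x|,
        forall x, P (P x) = P x &
        range P = A].

Definition subprojective (V : normedModType K) : Prop :=
  forall Y : set V, subspace Y ->
    exists Z : set V, [/\ Z `<=` Y, subspace Z & complemented Z].

End Subprojective.

Section Basis.
Context {K : numFieldType} {E : completeNormedModType K}.
Implicit Types (e : nat -> E) (a b : nat -> K) (z w : E).

Definition basis_expansion e a z : Prop :=
  series (fun n => a n *: e n) @ \oo --> z.

Definition schauder_basis e : Prop :=
  forall z, exists! a, basis_expansion e a z.

(* Unconditional constant 1 in the form |a_i| <= |b_i|, equivalent to invariance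
   of the norm under multiplying coefficients by scalars of modulus 1 (signs
   over the reals). The basis is not required to be normalized. *)
Definition unconditional1 e : Prop :=
  forall (N : nat) a b, (forall i, (i < N)%N -> `|a i| <= `|b i|) ->
    `|\sum_(i < N) a i *: e i| <= `|\sum_(i < N) b i *: e i|.

Definition unconditional1_basis e : Prop :=
  schauder_basis e /\ unconditional1 e.

Variable e : nat -> E.
Hypothesis he : unconditional1_basis e.

Lemma expansion_lim a z : basis_expansion e a z ->
  limn (series (fun n => a n *: e n)) = z.
Proof. by move=> az; apply/cvg_lim => //; exact: norm_hausdorff. Qed.

Lemma expansion_cvg a z : basis_expansion e a z ->
  cvgn (series (fun n => a n *: e n)).
Proof. by move=> az; apply/cvg_ex; exists z. Qed.

Lemma expansionD a b z w : basis_expansion e a z -> basis_expansion e b w ->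
  basis_expansion e (fun n => a n + b n) (z + w).
Proof.
move=> az bw; rewrite /basis_expansion.
rewrite (_ : series _ = series (fun n => a n *: e n) +
  series (fun n => b n *: e n)).
  exact: cvgD.
by rewrite -seriesD; congr series; apply/funext => n; rewrite scalerDl.
Qed.

Lemma expansionZ c a z : basis_expansion e a z ->
  basis_expansion e (fun n => c * a n) (c *: z).
Proof.
move=> az; rewrite /basis_expansion.
rewrite (_ : series _ = c *: series (fun n => a n *: e n)).
  exact: cvgZl_tmp.
by rewrite -seriesZ; congr series; apply/funext => n; rewrite -scalerA.
Qed.

Lemma expansionB a b z w : basis_expansion e a z -> basis_expansion e b w ->
  basis_expansion e (fun n => a n - b n) (z - w).
Proof.
move=> az bw; have {}bw := expansionZ (c := -1) bw.
rewrite -scaleN1r (_ : (fun n => _) = fun n => a n + -1 * b n); last first.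
  by apply/funext => n; rewrite mulN1r.
exact: expansionD.
Qed.

Lemma expansion0 : basis_expansion e (fun=> 0) 0.
Proof.
rewrite /basis_expansion (_ : series _ = cst 0); first exact: cvg_cst.
by apply/funext => n; rewrite /series/= big1// => i _; rewrite scale0r.
Qed.

Lemma expansion_delta (c : K) m :
  basis_expansion e (fun n => if n == m then c else 0) (c *: e m).
Proof.
apply: cvg_near_cst; exists m.+1 => // n /= mn; rewrite /series/=.
rewrite (bigD1_seq m) ?iota_uniq//= ?mem_index_iota// eqxx big1 ?addr0//.
by move=> i /negbTE ->; rewrite scale0r.
Qed.

Lemma expansion_exists z : exists a, basis_expansion e a z.
Proof. by have [a [? _]] := he.1 z; exists a. Qed.

Lemma expansion_inj a b z :
  basis_expansion e a z -> basis_expansion e b z -> a = b.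
Proof. by move=> az bz; have [c [_ cu]] := he.1 z; rewrite -(cu _ az) (cu _ bz). Qed.

Lemma basis_neq0 m : e m != 0.
Proof.
apply/eqP => em0; have := @expansion_delta 1 m.
rewrite em0 scaler0 => /(expansion_inj expansion0)/(congr1 (@^~ m)) /eqP.
by rewrite eqxx eq_sym oner_eq0.
Qed.

Lemma expansion_le a b z w : basis_expansion e a z -> basis_expansion e b w ->
  (forall n, `|a n| <= `|b n|) -> `|z| <= `|w|.
Proof.
move=> az bw ab; apply/ler_addgt0Pr => _/posnumP[d].
have d2 : 0 < d%:num / 2 by [].
near \oo => n.
have zn : `|z - series (fun n => a n *: e n) n| < d%:num / 2.
  by near: n; exact: (iffLR (cvgrPdist_lt _ _) az).
have wn : `|w - series (fun n => b n *: e n) n| < d%:num / 2.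
  by near: n; exact: (iffLR (cvgrPdist_lt _ _) bw).
have sn : `|series (fun n => a n *: e n) n| <= `|series (fun n => b n *: e n) n|.
  by rewrite /series/= !big_mkord; apply: he.2.
rewrite -[z](subrK (series (fun n => a n *: e n) n)).
rewrite (le_trans (ler_normD _ _))//.
rewrite [d%:num]splitr addrA addrC lerD//; first exact: ltW.
rewrite (le_trans sn)//.
rewrite -[X in `|X| <= _](subKr w) (le_trans (ler_normB _ _))//.
by rewrite lerD2l ltW.
Unshelve. all: by end_near. Qed.

Lemma expansion_dominated a b : (forall n, `|a n| <= `|b n|) ->
  cvgn (series (fun n => b n *: e n)) -> cvgn (series (fun n => a n *: e n)).
Proof.
move=> ab /cvg_cauchy/cauchy_seriesP cb.
apply/cauchy_cvgP/cauchy_seriesP => d d0.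
have := cb _ d0; apply: filterS => -[m n] /=; apply: le_lt_trans.
have E0 (c : nat -> K) : \sum_(m <= k < n) c k *: e k =
    \sum_(k < n) (if (m <= k)%N then c k else 0) *: e k.
  rewrite [RHS](bigID (fun k : 'I_n => m <= k)%N)/= [X in _ = _ + X]big1 ?addr0.
    by rewrite big_geq_mkord; apply: eq_bigr => k /= ->.
  by move=> k /negbTE ->; rewrite scale0r.
rewrite !E0.
apply: (he.2 n (fun k => if (m <= k)%N then a k else 0)
  (fun k => if (m <= k)%N then b k else 0)) => i _.
by case: ifP => // _; exact: ab.
Qed.

Lemma coef_le a z m : basis_expansion e a z -> `|a m| * `|e m| <= `|z|.
Proof.
move=> az; rewrite -normrZ; apply: (expansion_le (@expansion_delta (a m) m) az).
by move=> n; case: eqVneq => [->//|_]; rewrite normr0.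
Qed.

Lemma expansion_limit (T : Type) (F : set_system T) (FF : ProperFilter F)
    (f : T -> nat -> K) (g : T -> E) a z :
  (forall t, basis_expansion e (f t) (g t)) -> g @ F --> z ->
  (forall n, (fun t => f t n) @ F --> (a n : K^o)) -> basis_expansion e a z.
Proof.
move=> fg gz fa; have [a' a'z] := expansion_exists z.
suff -> : a = a' by [].
apply/funext => n.
apply: (@cvg_unique K^o (@norm_hausdorff K K^o) _ _ _ _ (fa n)).
apply/cvgrPdist_lt => d d0.
have dn : 0 < d * `|e n| by rewrite mulr_gt0// normr_gt0 basis_neq0.
move/cvgrPdist_lt : gz => /(_ _ dn); apply: filterS => t.
have := coef_le n (expansionB a'z (fg t)) => /= le lt.
rewrite -(ltr_pM2r (_ : 0 < `|e n|)) ?normr_gt0 ?basis_neq0//.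
exact: le_lt_trans lt.
Qed.

End Basis.

(* The space (\sum_n X_n)_E. The scalar sequence (`|x n|)_n is the coordinate
   sequence of an element of E exactly when the series \sum_n `|x n| *: e n
   converges, and that element is then its sum [bsum_abs x]. *)
Section Sum.
Context {K : numFieldType} {E : completeNormedModType K} {e : nat -> E}.

Record banach_sum (he : unconditional1_basis e) (X : nat -> completeNormedModType K)
  : Type := BanachSum {
  bsum_val :> forall n, X n;
  bsum_cvg : cvgn (series (fun n => `|bsum_val n| *: e n)) }.

Variables (he : unconditional1_basis e) (X : nat -> completeNormedModType K).
Local Notation S := (banach_sum he X).
Implicit Types x y z : S.

Definition bsum_abs x : E := limn (series (fun n => `|x n| *: e n)).

Definition bsum_norm x : K := `|bsum_abs x|.

Lemma bsum_absP x : basis_expansion e (fun n => `|x n|) (bsum_abs x).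
Proof. exact: (@bsum_cvg _ _ x). Qed.
Arguments bsum_absP : clear implicits.

Lemma bsum_ext x y : (forall n, x n = y n) -> x = y.
Proof.
case: x y => [x cx] [y cy] /= xy.
have {}xy : x = y by apply: functional_extensionality_dep.
by move: cx cy; rewrite xy => cx cy; congr BanachSum; exact: Prop_irrelevance.
Qed.

HB.instance Definition _ := gen_eqMixin S.
HB.instance Definition _ := gen_choiceMixin S.

Lemma bsum_zero_cvg : cvgn (series (fun n => `|0 : X n| *: e n)).
Proof.
under eq_fun do rewrite normr0.
exact: (expansion_cvg (expansion0 e)).
Qed.

Lemma bsum_opp_cvg x : cvgn (series (fun n => `|- x n| *: e n)).
Proof. by under eq_fun do rewrite normrN; exact: (@bsum_cvg _ _ x). Qed.

Lemma bsum_add_cvg x y : cvgn (series (fun n => `|x n + y n| *: e n)).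
Proof.
have := expansion_cvg (expansionD (bsum_absP x) (bsum_absP y)).
apply: (expansion_dominated he) => n.
by rewrite normr_id (ger0_norm (addr_ge0 _ _))// ler_normD.
Qed.

Lemma bsum_scale_cvg (c : K) x : cvgn (series (fun n => `|c *: x n| *: e n)).
Proof.
under eq_fun do rewrite normrZ.
exact: (expansion_cvg (expansionZ (c := `|c|) (bsum_absP x))).
Qed.

Definition bsum_zero : S := @BanachSum he X (fun n => 0) (@bsum_zero_cvg).
Definition bsum_opp x : S := @BanachSum he X (fun n => - x n) (@bsum_opp_cvg x).
Definition bsum_add x y : S :=
  @BanachSum he X (fun n => x n + y n) (@bsum_add_cvg x y).
Definition bsum_scale (c : K) x : S :=
  @BanachSum he X (fun n => c *: x n) (@bsum_scale_cvg c x).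

Fact bsum_addA : associative bsum_add.
Proof. by move=> x y z; apply: bsum_ext => n /=; rewrite addrA. Qed.
Fact bsum_addC : commutative bsum_add.
Proof. by move=> x y; apply: bsum_ext => n /=; rewrite addrC. Qed.
Fact bsum_add0 : left_id bsum_zero bsum_add.
Proof. by move=> x; apply: bsum_ext => n /=; rewrite add0r. Qed.
Fact bsum_addN : left_inverse bsum_zero bsum_opp bsum_add.
Proof. by move=> x; apply: bsum_ext => n /=; rewrite addNr. Qed.

HB.instance Definition _ :=
  GRing.isZmodule.Build S bsum_addA bsum_addC bsum_add0 bsum_addN.

Fact bsum_scaleA (a b : K) x :
  bsum_scale a (bsum_scale b x) = bsum_scale (a * b) x.
Proof. by apply: bsum_ext => n /=; rewrite scalerA. Qed.
Fact bsum_scale1 : left_id 1 bsum_scale.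
Proof. by move=> x; apply: bsum_ext => n /=; rewrite scale1r. Qed.
Fact bsum_scaleDr : right_distributive bsum_scale +%R.
Proof. by move=> c x y; apply: bsum_ext => n /=; rewrite scalerDr. Qed.
Fact bsum_scaleDl x : {morph bsum_scale^~ x : a b / a + b}.
Proof. by move=> a b; apply: bsum_ext => n /=; rewrite scalerDl. Qed.

HB.instance Definition _ := GRing.Zmodule_isLmodule.Build K S
  bsum_scaleA bsum_scale1 bsum_scaleDr bsum_scaleDl.

Fact bsum_normD x y : bsum_norm (x + y) <= bsum_norm x + bsum_norm y.
Proof.
rewrite /bsum_norm (le_trans _ (ler_normD _ _))//.
apply: (expansion_le he (bsum_absP _) (expansionD (bsum_absP x) (bsum_absP y))).
by move=> n; rewrite normr_id (ger0_norm (addr_ge0 _ _))// ler_normD.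
Qed.

Fact bsum_normZ (c : K) x : bsum_norm (c *: x) = `|c| * bsum_norm x.
Proof.
rewrite /bsum_norm -[`|c|]normr_id -normrZ; congr (`|_|).
apply: expansion_lim; under eq_fun do rewrite normrZ.
exact: (expansionZ (c := `|c|) (bsum_absP x)).
Qed.

Fact bsum_norm0_eq0 x : bsum_norm x = 0 -> x = 0.
Proof.
move=> /eqP; rewrite normr_eq0 => /eqP x0; apply: bsum_ext => n.
have := bsum_absP x; rewrite x0 => /(expansion_inj he (expansion0 e)).
by move=> /(congr1 (@^~ n)) /esym/eqP; rewrite normr_eq0 => /eqP.
Qed.

HB.instance Definition _ := Lmodule_isNormed.Build K S
  bsum_normD bsum_normZ bsum_norm0_eq0.

Lemma bsum_normE x : `|x| = `|bsum_abs x|.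
Proof. by []. Qed.

Lemma bsum_coord_le n x : `|x n| * `|e n| <= `|x|.
Proof. by have := coef_le he n (bsum_absP x); rewrite normr_id. Qed.

Lemma bsum_abs_dist x y : `|bsum_abs x - bsum_abs y| <= `|x - y|.
Proof.
apply: (expansion_le he (expansionB (bsum_absP x) (bsum_absP y)) (bsum_absP _)).
by move=> n; rewrite normr_id ler_dist_dist.
Qed.

Lemma bsum_complete (F : set_system S) : ProperFilter F -> cauchy F -> cvg F.
Proof.
move=> FF cF.
have cF2 d : 0 < d -> exists2 A, F A & forall x y, A x -> A y -> `|x - y| < d.
  move=> d0; have /cauchy_ballP/(_ _ d0) [[A B] /= [FA FB] AB] := cF.
  exists (A `&` B); first exact: filterI.
  move=> x y [Ax _] [_ By]; have := AB (x, y) (conj Ax By).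
  by rewrite -ball_normE.
have lipF (V : completeNormedModType K) (f : S -> V) (k : K) : 0 < k ->
    (forall x y, k * `|f x - f y| <= `|x - y|) -> cvg (f @ F).
  move=> k0 kf; apply: cauchy_cvg; apply/cauchy_ballP => d d0.
  have [A FA Ad] := cF2 _ (mulr_gt0 k0 d0).
  exists (f @` A, f @` A) => /=.
    have fA : F (f @^-1` (f @` A)) by apply: filterS FA => x Ax; exists x.
    by split.
  move=> [_ _] /= [[x Ax <-] [y Ay <-]]; rewrite -ball_normE /=.
  by rewrite -(ltr_pM2l k0); apply: le_lt_trans (kf x y) _; exact: Ad.
have cX n : cvg ((fun x : S => x n) @ F).
  apply: (lipF (X n) _ `|e n|); first by rewrite normr_gt0 (basis_neq0 he).
  by move=> x y; rewrite mulrC; exact: (bsum_coord_le n (x - y)).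
pose l n := lim ((fun x : S => x n) @ F).
have absl (y : S) :
    exists2 v, (fun x => bsum_abs (x - y)) @ F --> v &
      basis_expansion e (fun n => `|l n - y n|) v.
  have /cvg_ex[v vF] : cvg ((fun x => bsum_abs (x - y)) @ F).
    apply: (lipF E _ 1) => // x z; rewrite mul1r.
    by rewrite (le_trans (bsum_abs_dist _ _))// opprB addrA subrK.
  exists v => //.
  apply: (@expansion_limit _ _ _ he _ F FF (fun x n => `|x n - y n|)
    (fun x => bsum_abs (x - y))) => //.
    by move=> x; exact: (bsum_absP (x - y)).
  move=> n; apply: (@cvg_norm _ _ _ F _ (fun x : S => x n - y n)).
  by apply: cvgB; [exact: cX|exact: cvg_cst].
have cl : cvgn (series (fun n => `|l n| *: e n)).
  have [v _ vl] := absl 0; apply/cvg_ex; exists v; move: vl.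
  by rewrite /basis_expansion; under eq_fun do rewrite subr0.
pose L : S := @BanachSum he X l cl.
apply/cvg_ex; exists L; apply/cvgrPdist_le => d d0.
have [A FA Ad] := cF2 _ d0; apply: (filterS _ FA) => y Ay.
have [v vF vl] := absl y.
rewrite bsum_normE (_ : bsum_abs (L - y) = v); last exact: expansion_lim.
apply/ler_addgt0Pr => r r0.
have [x [Ax xr]] : exists x, A x /\ `|v - bsum_abs (x - y)| < r.
  apply: (@filter_ex _ F); apply: filterI => //.
  exact: (iffLR (cvgrPdist_lt _ _) vF).
rewrite -[v](subrK (bsum_abs (x - y))) (le_trans (ler_normD _ _))//.
by rewrite addrC lerD// ltW// -bsum_normE Ad.
Qed.

HB.instance Definition _ := Uniform_isComplete.Build S bsum_complete.

End Sum.

Arguments bsum_absP {K E e he X} x.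

(* Main.v *)
From HB Require Import structures.
Require Import Defs.
From mathcomp Require Import all_boot all_order all_algebra.
From mathcomp Require Import all_classical all_reals all_analysis.
From mathcomp Require Import complex.
From mathcomp Require Import ring lra.

Set Implicit Arguments.
Unset Strict Implicit.
Unset Printing Implicit Defensive.

Import Order.TTheory GRing.Theory Num.Theory.
Import numFieldNormedType.Exports.
Local Open Scope classical_set_scope.
Local Open Scope ring_scope.
Local Open Scope complex_scope.

(** Everything rests on one transfer principle, [complemented_lift]: if a bounded
    operator [T : V -> W] from a Banach space into a subprojective space is
    bounded below on a subspace [B], then [B] contains a subspace complemented in
    [V]. Indeed [T B] is a subspace of [W], so it contains some [Z0] with a
    projection [P], and [(T|B)^-1 P T] projects [V] onto [(T|B)^-1 Z0]. Applied to
    the isometric copies of [X] and [Y] in [X * Y], and to the copies of each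
    [X n] and of [E] in the sum, it shows that subprojectivity passes from the
    large space to its constituents.

    For the other direction, the task is to find, inside a given subspace [A], a
    further subspace on which some bounded operator into one of the constituents
    is bounded below. If an operator [T] is bounded below on no subspace of [A],
    then every subspace of [A] contains a further one on which [T] has arbitrarily
    small norm ([bounded_below_or_small]). In [X * Y] this settles the matter:
    where the first projection is small, the second one is isometric.

    In the sum, the remaining case is the one where every coordinate map can be
    made small. Then [A] contains normalized vectors [z k] that are, up to a small
    error, supported on disjoint successive blocks of coordinates
    ([gliding_hump]). Choose on each [X n] a functional of norm at most one that
    norms the [n]-th coordinate of the [z k] whose block contains [n]. Applying
    these functionals coordinatewise gives an operator from the sum to [E] which,
    by 1-unconditionality, is isometric on combinations of the truncated [z k],
    hence bounded below on the closed span of the [z k]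
    ([complemented_of_small_on_coordinates]). The transfer principle for this
    operator replaces the usual perturbation of complemented block subspaces.

    Both constructions choose their vectors one after the other, each in the kernels
    of norming functionals of its predecessors ([triangular_sequence]); this
    controls the [k]-th coefficient of a combination by [2 ^+ k] times its norm,
    which errors decaying like [4 ^- k] absorb. Norming functionals come from the
    Hahn-Banach theorem, which is the only point where the scalars have to be
    real or complex. *)

(* The topology library has its own notion called subspace. *)
Local Notation subspace := Defs.subspace.

(** * The Hahn-Banach theorem *)

Section SublinearFunctionals.
Context {R : realType} {K : numFieldType} (i : {rmorphism R -> K}).
Context {V : lmodType K}.
Implicit Types (q : V -> R) (v x y : V).

(** Only multiplication by real scalars is involved, through the embedding [i], so
    that real and complex vector spaces can share the argument. *)
Definition sublinear q : Prop :=
  (forall x y, q (x + y) <= q x + q y) /\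
  (forall (t : R) x, 0 <= t -> q (i t *: x) <= t * q x).

Lemma sublinear_ge0 q : sublinear q -> 0 <= q 0.
Proof. by case=> qD _; have := qD 0 0; rewrite addr0; lra. Qed.

Lemma sublinear_le0 q : sublinear q -> q 0 <= 0.
Proof. by case=> _ /(_ 0 0 (lexx _)); rewrite scaler0 mul0r. Qed.

Lemma sublinear_geN q x : sublinear q -> - q (- x) <= q x.
Proof.
move=> qs; have := sublinear_ge0 qs; have := qs.1 x (- x).
by rewrite subrr; lra.
Qed.

Lemma sublinearZ q (t : R) x : sublinear q -> 0 <= t -> q (i t *: x) = t * q x.
Proof.
move=> qs; rewrite le_eqVlt => /orP[/eqP <-|t0].
  rewrite rmorph0 scale0r mul0r; apply: le_anti.
  by rewrite sublinear_ge0// sublinear_le0.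
apply: le_anti; rewrite (qs.2 _ _ (ltW t0))/=.
have ti : 0 <= t^-1 by rewrite invr_ge0 ltW.
have := qs.2 _ (i t *: x) ti; rewrite scalerA -rmorphM mulVf ?gt_eqF// rmorph1 scale1r.
by rewrite ler_pdivlMl.
Qed.

Definition slide_set q v x : set R :=
  [set q (x + i t *: v) - t * q v | t in [set t : R | 0 <= t]].

(** The infimal slope of [q] along the ray from [x] in direction [v]. It is again
    sublinear and below [q], and it is the sublinear functional that a minimal
    one has to coincide with. *)
Definition slide q v x : R := inf (slide_set q v x).

Lemma slide_set_lb q v x : sublinear q -> lbound (slide_set q v x) (- q (- x)).
Proof.
move=> qs _ [t /= t0 <-].
have := qs.1 (- x) (x + i t *: v); have := sublinearZ v qs t0.
by rewrite addKr; lra.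
Qed.

Lemma slide_set_n0 q v x : slide_set q v x !=set0.
Proof. by exists (q (x + i 0 *: v) - 0 * q v); exists 0 => /=. Qed.

Lemma slide_le q v x (t : R) : sublinear q -> 0 <= t ->
  slide q v x <= q (x + i t *: v) - t * q v.
Proof.
move=> qs t0; apply: ge_inf; last by exists t.
by exists (- q (- x)); exact: slide_set_lb.
Qed.

Lemma slide_ge q v x c :
  (forall t, 0 <= t -> c <= q (x + i t *: v) - t * q v) -> c <= slide q v x.
Proof.
move=> cq; apply: lb_le_inf; first exact: slide_set_n0.
by move=> _ [t /= t0 <-]; exact: cq.
Qed.

Lemma slide_sublinear q v : sublinear q -> sublinear (slide q v).
Proof.
move=> qs; split=> [x y|t x].
- rewrite -lerBlDr; apply: slide_ge => s s0; rewrite lerBlDr -lerBlDl.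
  apply: slide_ge => t t0; rewrite lerBlDr.
  apply: (le_trans (slide_le v (x + y) qs (addr_ge0 s0 t0))).
  have := qs.1 (x + i s *: v) (y + i t *: v).
  by rewrite addrACA -scalerDl -rmorphD; lra.
- rewrite le_eqVlt => /orP[/eqP <-|t0].
    rewrite rmorph0 scale0r mul0r.
    have := slide_le v 0 qs (lexx 0).
    by rewrite rmorph0 scale0r addr0 mul0r subr0 => /le_trans; apply; exact: sublinear_le0.
  rewrite mulrC -ler_pdivrMr//; apply: slide_ge => s s0; rewrite ler_pdivrMr//.
  apply: (le_trans (slide_le v _ qs (mulr_ge0 s0 (ltW t0)))).
  have := qs.2 _ (x + i s *: v) (ltW t0).
  by rewrite scalerDr scalerA -rmorphM [t * s]mulrC; nra.
Qed.

Lemma slide_le_id q v x : sublinear q -> slide q v x <= q x.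
Proof.
by move=> qs; have := slide_le v x qs (lexx 0); rewrite rmorph0 scale0r addr0 mul0r subr0.
Qed.

(** Zorn's lemma applies because the pointwise infimum of a chain is sublinear;
    it is finite since [- q (- x)] bounds every member from below. *)
Lemma exists_minimal_sublinear q : sublinear q ->
  exists g, [/\ sublinear g, forall x, g x <= q x &
    forall h, sublinear h -> (forall x, h x <= g x) -> h = g].
Proof.
move=> qs.
pose T := {g : V -> R | sublinear g /\ forall x, g x <= q x}.
pose r (g h : T) := `[< forall x, sval h x <= sval g x >].
have [| | |A Atot|[g [gs gq]] gmin] := @Zorn T r.
- by move=> g; apply/asboolP => x.
- move=> f g h /asboolP fg /asboolP gh; apply/asboolP => x.
  exact: le_trans (gh x) (fg x).
- move=> [g gP] [h hP] /asboolP /= gh /asboolP /= hg; apply: eq_exist => /=.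
  by apply/funext => x; apply: le_anti; rewrite gh hg.
- have [->|/set0P[g0 Ag0]] := eqVneq A set0.
    by exists (exist _ q (conj qs (fun=> lexx _))) => s [].
  pose I x := [set sval g x | g in A].
  have Ilb x : lbound (I x) (- q (- x)).
    move=> _ [[g [gs gq]] /= _ <-].
    by rewrite (le_trans _ (sublinear_geN x gs))// lerN2.
  have In0 x : I x !=set0 by exists (sval g0 x); exists g0.
  pose m x := inf (I x).
  have mle g x : A g -> m x <= sval g x.
    move=> Ag; apply: ge_inf; last by exists g.
    by exists (- q (- x)).
  have mge x c : (forall g, A g -> c <= sval g x) -> c <= m x.
    by move=> cg; apply: lb_le_inf => // _ [g Ag <-]; exact: cg.
  have ms : sublinear m.
    split=> [x y|t x t0].
    + rewrite -lerBlDr; apply: (mge _) => g Ag; rewrite lerBlDr -lerBlDl.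
      apply: (mge y) => h Ah; rewrite lerBlDr.
      have [/asboolP gh|/asboolP hg] := Atot _ _ Ag Ah.
      * apply: (le_trans (mle _ _ Ah)); apply: (le_trans ((svalP h).1.1 x y)).
        by rewrite addrC lerD2l.
      * apply: (le_trans (mle _ _ Ag)); apply: (le_trans ((svalP g).1.1 x y)).
        by rewrite addrC lerD2r.
    + move: t0; rewrite le_eqVlt => /orP[/eqP <-|t0].
        rewrite rmorph0 scale0r mul0r (le_trans (mle _ _ Ag0))//.
        exact: sublinear_le0 (svalP g0).1.
      rewrite mulrC -ler_pdivrMr//; apply: (mge _) => g Ag; rewrite ler_pdivrMr//.
      apply: (le_trans (mle _ _ Ag)); rewrite mulrC.
      exact: (svalP g).1.2 (ltW t0).
  have mq x : m x <= q x by apply: (le_trans (mle _ _ Ag0)); exact: (svalP g0).2.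
  exists (exist _ m (conj ms mq)) => g Ag; apply/asboolP => x /=; exact: mle.
exists g; split=> // h hs hg.
have hP : sublinear h /\ forall x, h x <= q x.
  by split=> // x; exact: le_trans (hg x) (gq x).
by have /(congr1 sval) := gmin (exist _ h hP) (asboolT hg).
Qed.

(** Minimality forces [slide g y = g]; the value of the slide at parameter [1]
    then gives the superadditivity [g x + g y <= g (x + y)]. *)
Lemma minimal_sublinear_linear g : sublinear g ->
  (forall h, sublinear h -> (forall x, h x <= g x) -> h = g) ->
  (forall x y, g (x + y) = g x + g y) /\ (forall t x, g (i t *: x) = t * g x).
Proof.
move=> gs gmin.
have gD x y : g (x + y) = g x + g y.
  apply: le_anti; rewrite gs.1 /=.
  have <- : slide g y = g.
    by apply: gmin => [|z]; [exact: slide_sublinear|exact: slide_le_id].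
  have := slide_le y x gs ler01.
  rewrite rmorph1 scale1r mul1r.
  have -> : slide g y = g.
    by apply: gmin => [|z]; [exact: slide_sublinear|exact: slide_le_id].
  by lra.
have g0 : g 0 = 0.
  by have := gD 0 0; rewrite addr0; lra.
have gN x : g (- x) = - g x.
  by have := gD x (- x); rewrite subrr g0; lra.
split=> // t x.
have gZ s z : 0 <= s -> g (i s *: z) = s * g z.
  move=> s0; apply: le_anti; rewrite gs.2//=.
  by have := gs.2 s (- z) s0; rewrite scalerN !gN mulrN lerN2.
have [t0|/ltW t0] := leP 0 t; first exact: gZ.
have tN : 0 <= - t by rewrite oppr_ge0.
by rewrite -[t]opprK rmorphN scaleNr gN (gZ _ _ tN) [RHS]mulNr.
Qed.

(** Minimizing below [slide q x] rather than below [q] forces [g x = q x], since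
    [slide q x] takes a value at most [- q x] at [- x]. *)
Lemma hahn_banach_sublinear q x : sublinear q ->
  exists g : V -> R, [/\ forall y z, g (y + z) = g y + g z,
    forall t y, g (i t *: y) = t * g y, forall y, g y <= q y & g x = q x].
Proof.
move=> qs.
have [g [gs gq gmin]] := exists_minimal_sublinear (slide_sublinear x qs).
have [gD gZ] := minimal_sublinear_linear gs gmin.
exists g; split=> //.
  by move=> y; apply: le_trans (gq y) (slide_le_id _ _ qs).
apply: le_anti; rewrite (le_trans (gq x) (slide_le_id _ _ qs))/=.
have := le_trans (gq (- x)) (slide_le x (- x) qs ler01).
rewrite rmorph1 scale1r addNr mul1r.
have := gZ (-1) x; rewrite rmorphN1 scaleN1r => ->.
by have := sublinear_le0 qs; lra.
Qed.

End SublinearFunctionals.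

Definition norming_functionals (K : numFieldType) : Prop :=
  forall (V : normedModType K) (x : V),
  exists f : {scalar V}, (forall y, `|f y| <= `|y|) /\ f x = `|x|.

Lemma real_norming_functionals (R : realType) : norming_functionals R.
Proof.
move=> V x.
have ps : sublinear idfun (fun y : V => `|y|).
  split=> [y z|t y t0]; first exact: ler_normD.
  by rewrite normrZ ger0_norm.
have [g [gD gZ gn gx]] := hahn_banach_sublinear x ps.
have gl : linear_for *%R g.
  by move=> a y z; rewrite gD -{1}[a]/(idfun a) gZ.
pose G := GRing.isLinear.Build R V R *%R g gl.
pose f : {scalar V} := HB.pack g G.
exists f; split=> // y.
have /= gN := gZ (-1) y; rewrite scaleN1r mulN1r in gN.
by rewrite ler_norml gn andbT -lerN2 opprK -gN -[leRHS]normrN.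
Qed.

(** A complex functional is determined by its real part [g], as
    [y |-> g y - 'i * g ('i *: y)]. The bound [g <= p] extends to the modulus of
    the whole functional after rotating [y] by the conjugate of its value. *)
Lemma complex_norming_functionals (R : realType) : norming_functionals R[i].
Proof.
move=> V x.
pose p (y : V) : R := complex.Re `|y|.
have pE y : `|y| = (p y)%:C.
  have := normr_ge0 y; rewrite lecE /p => /andP[/eqP /= y0 _].
  by case: (`|y|) y0 => a b /= ->.
have ps : sublinear (real_complex R) p.
  split=> [y z|t y t0].
    by rewrite -lecR rmorphD/= -!pE ler_normD.
  by rewrite -lecR rmorphM/= -!pE normrZ ger0_norm// ler0c.
have [g [gD gZ gn gx]] := hahn_banach_sublinear x ps.
have gN y : g (- y) = - g y.
  by have := gZ (-1) y; rewrite rmorphN1 scaleN1r mulN1r.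
pose I : R[i] := 0 +i* 1.
have gC (u v : R) y : g ((u +i* v) *: y) = u * g y + v * g (I *: y).
  rewrite -gZ -gZ -gD; congr g; rewrite scalerA -scalerDl; congr (_ *: _).
  by apply/eqP; rewrite eq_complex /=; apply/andP; split; apply/eqP; ring.
pose F (y : V) : R[i] := g y +i* - g (I *: y).
have F_linear : linear_for *%R F.
  move=> [u v] y z; rewrite /F gD (gC u v) scalerDr gD scalerA.
  have -> : I * (u +i* v) = (- v) +i* u.
    by apply/eqP; rewrite eq_complex /=; apply/andP; split; apply/eqP; ring.
  rewrite (gC (- v) u).
  by apply/eqP; rewrite eq_complex /=; apply/andP; split; apply/eqP; ring.
have F_le y : `|F y| <= `|y|.
  have [->|F0] := eqVneq (F y) 0; first by rewrite normr0.
  have FP : 0 < `|F y| by rewrite normr_gt0.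
  (* multiplying y by the conjugate of F y makes the value of F real *)
  rewrite -(ler_pM2l FP) -expr2 -add_Re2_Im2.
  have -> : `|F y| = `|(g y +i* g (I *: y))%C|.
    by rewrite !normc_def /= sqrrN.
  rewrite -normrZ pE lecR /=.
  by apply: le_trans (gn _); rewrite (gC (g y)) sqrrN !expr2.
pose G := GRing.isLinear.Build R[i] V R[i] *%R F F_linear.
pose f : {scalar V} := HB.pack F G.
exists f; split=> //.
have Fx : complex.Re (F x) = p x by rewrite /= gx.
have := F_le x; rewrite -(@ler_pXn2r _ 2)// ?nnegrE// -add_Re2_Im2 pE -rmorphXn lecR Fx.
rewrite gerDl => Im0; have {Im0} : complex.Im (F x) = 0.
  by apply/eqP; rewrite -sqrf_eq0 eq_le Im0 sqr_ge0.
by rewrite -Fx => F0; rewrite -[LHS]/(F x) [LHS]complexE F0 mulr0 addr0.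
Qed.

Lemma RC_norming_functionals (R : realType) (K : numFieldType) :
  K = R :> numFieldType \/ K = R[i] :> numFieldType -> norming_functionals K.
Proof.
by move=> [->|->]; [exact: real_norming_functionals|exact: complex_norming_functionals].
Qed.

(** * Infinite dimensional linear subspaces *)

Section LinearAlgebra.
Context {K : numFieldType} {V W : lmodType K}.
Implicit Types (A B : set V).

Lemma linear_subspace_sum A (n : nat) (c : 'I_n -> K) (v : 'I_n -> V) :
  linear_subspace A -> (forall i, A (v i)) -> A (\sum_(i < n) c i *: v i).
Proof.
move=> [A0 Al] Av; apply: (@big_ind _ A) => //.
  by move=> x y Ax Ay; rewrite -[x]scale1r; exact: Al.
by move=> i _; rewrite -[_ *: _]addr0; exact: Al.
Qed.

Lemma infinite_dimensional_kernel A (f : {scalar V}) :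
  linear_subspace A -> ~ finite_dimensional A ->
  ~ finite_dimensional (A `&` [set x | f x = 0]).
Proof.
move=> [A0 Al] Ainf [n [v [vA vspan]]]; apply: Ainf.
have [[a [Aa fa]]|f0] := pselect (exists a, A a /\ f a != 0); last first.
  exists n, v; split=> [i|x Ax]; first by have [] := vA i.
  apply: vspan; split=> //=; apply: contrapT => /eqP fx.
  by apply: f0; exists x.
pose w (i : 'I_n.+1) := if unlift ord0 i is Some j then v j else a.
exists n.+1, w; split=> [i|x Ax].
  by rewrite /w; case: unliftP => [j _|//]; have [] := vA j.
have [|c cE] := vspan (- (f x / f a) *: a + x).
  split; first exact: Al.
  by rewrite /= linearP /= mulNr divfK// addNr.
exists (fun i => if unlift ord0 i is Some j then c j else f x / f a).
rewrite big_ord_recl /w unlift_none.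
under eq_bigr do rewrite liftK.
by rewrite -cE scaleNr addNKr.
Qed.

(** If [n] vectors spanned [A], the coefficient matrix of [n.+1] vectors [z k] would
    have a nonzero left kernel, that is, a nontrivial relation. *)
Lemma infinite_dimensional_free A (z : nat -> V) :
  (forall k, A (z k)) ->
  (forall n (a : nat -> K), \sum_(i < n) a i *: z i = 0 ->
     forall i, (i < n)%N -> a i = 0) ->
  ~ finite_dimensional A.
Proof.
move=> Az zfree [n [v [vA vspan]]].
have /choice[c cE] k : exists c : 'I_n -> K, z k = \sum_(i < n) c i *: v i.
  exact: vspan.
pose C : 'M[K]_(n.+1, n) := \matrix_(k, i) c k i.
have : kermx C != 0.
  rewrite -mxrank_eq0 mxrank_ker -lt0n subn_gt0 ltnS.
  exact: rank_leq_col.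
move=> /rowV0Pn[a /sub_kermxP aC /eqP]; apply; apply/rowP => i; rewrite mxE.
have := zfree n.+1 (fun k => a 0 (inord k)) _ i (ltn_ord i).
rewrite inord_val; apply.
under eq_bigr => k _ do rewrite inord_val cE scaler_sumr.
rewrite exchange_big /= big1// => j _.
under eq_bigr do rewrite scalerA.
rewrite -scaler_suml; move/rowP/(_ j) : aC; rewrite !mxE.
by under eq_bigr do rewrite mxE; move=> ->; rewrite scale0r.
Qed.

Lemma infinite_dimensional_image A (T : {linear V -> W}) :
  linear_subspace A -> (forall x, A x -> T x = 0 -> x = 0) ->
  ~ finite_dimensional A -> ~ finite_dimensional (T @` A).
Proof.
move=> Alin Tinj Ainf [n [w [wA wspan]]]; apply: Ainf.
have /choice[v vP] i : exists x, A x /\ T x = w i by have [x Ax <-] := wA i; exists x.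
exists n, v; split=> [i|x Ax]; first by have [] := vP i.
have [c cE] := wspan _ (ex_intro2 _ _ x Ax erefl).
exists c; apply/eqP; rewrite -subr_eq0; apply/eqP; apply: Tinj.
  rewrite addrC -scaleN1r; apply Alin.2 => //.
  by apply: linear_subspace_sum => // i; have [] := vP i.
rewrite linearB linear_sum cE /=; apply/eqP; rewrite subr_eq0; apply/eqP.
by apply: eq_bigr => i _; rewrite linearZ /= (vP i).2.
Qed.

Lemma finite_dimensional_image A (T : {linear V -> W}) :
  finite_dimensional A -> finite_dimensional (T @` A).
Proof.
move=> [n [v [vA vspan]]]; exists n, (T \o v); split=> [i|_ [x Ax <-]].
  by exists (v i).
have [c ->] := vspan _ Ax; exists c.
by rewrite linear_sum; apply: eq_bigr => i _; rewrite linearZ.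
Qed.

Lemma linear_subspaceI A B :
  linear_subspace A -> linear_subspace B -> linear_subspace (A `&` B).
Proof.
move=> [A0 Al] [B0 Bl]; split=> // c x y [Ax Bx] [Ay By].
by split; [exact: Al|exact: Bl].
Qed.

Lemma linear_subspace_preimage (T : {linear V -> W}) (B : set W) :
  linear_subspace B -> linear_subspace (T @^-1` B).
Proof.
move=> [B0 Bl]; split=> [|c x y /= Bx By]; first by rewrite /preimage/= linear0.
by rewrite linearP; exact: Bl.
Qed.

Lemma linear_subspace_image (T : {linear V -> W}) A :
  linear_subspace A -> linear_subspace (T @` A).
Proof.
move=> [A0 Al]; split=> [|c _ _ [x Ax <-] [y Ay <-]].
  by exists 0 => //; rewrite linear0.
by exists (c *: x + y); [exact: Al|rewrite linearP].
Qed.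

End LinearAlgebra.

(** * Subspaces of normed spaces *)

Section NormedSubspaces.
Context {K : numFieldType}.

Lemma closure_normP (V : normedModType K) (A : set V) x :
  closure A x <-> forall d, 0 < d -> exists2 y, A y & `|x - y| < d.
Proof.
split=> [clx d d0|Ax B /nbhs_ballP[d /= d0 dB]].
  have [y [Ay xy]] := clx _ (nbhsx_ballx x d d0).
  by exists y => //; move: xy; rewrite -ball_normE.
have [y Ay xy] := Ax _ d0.
by exists y; split=> //; apply: dB; rewrite -ball_normE.
Qed.

Lemma closed_normP (V : normedModType K) (A : set V) :
  closed A <->
  forall x, (forall d, 0 < d -> exists2 y, A y & `|x - y| < d) -> A x.
Proof.
by split=> Acl x /closure_normP; exact: Acl.
Qed.

Lemma closed_preimage_bounded (V W : normedModType K) (T : {linear V -> W})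
    (M : K) (B : set W) :
  0 < M -> (forall x, `|T x| <= M * `|x|) -> closed B -> closed (T @^-1` B).
Proof.
move=> M0 TM /closed_normP Bcl; apply/closed_normP => x xB; apply: Bcl => d d0.
have [y By xy] := xB (d / M) (divr_gt0 d0 M0); exists (T y) => //.
by rewrite -linearB (le_lt_trans (TM _))// mulrC -ltr_pdivlMr.
Qed.

(** The constant in a bound over [K] need not be positive, nor even real. *)
Lemma bound_gt0 (V W : normedModType K) (T : {linear V -> W}) (M : K) :
  (forall x, `|T x| <= M * `|x|) ->
  exists2 M', 0 < M' & forall x, `|T x| <= M' * `|x|.
Proof.
move=> TM; exists (`|M| + 1) => [|x]; first by rewrite ltr_wpDl.
have Mx : 0 <= M * `|x| by apply: le_trans (TM x).
rewrite (le_trans (TM x))// -(ger0_norm Mx) normrM normr_id.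
by rewrite ler_wpM2r// lerDl.
Qed.

Lemma subspaceI_kernel (V : normedModType K) (A : set V) (f : {scalar V}) :
  (forall x, `|f x| <= `|x|) -> subspace A ->
  subspace (A `&` [set x | f x = 0]).
Proof.
move=> f1 [Al Acl Ainf]; split.
- apply: linear_subspaceI => //; split=> /= [|c x y fx fy]; first exact: linear0.
  by rewrite linearP /= fx fy mulr0 addr0.
- apply: closedI => //; apply/closed_normP => x /= xf.
  apply/eqP; rewrite -normr_le0; apply/ler_addgt0Pr => d d0; rewrite add0r.
  have [y /= fy xy] := xf _ d0.
  by rewrite -[f x]subr0 -fy -raddfB (le_trans (f1 _))// ltW.
- exact: infinite_dimensional_kernel.
Qed.

Lemma unit_vector (V : normedModType K) (B : set V) :
  linear_subspace B -> ~ finite_dimensional B -> exists2 z, B z & `|z| = 1.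
Proof.
move=> [B0 Bl] Binf.
have [v [Bv v0]] : exists v, B v /\ v != 0.
  apply: contrapT => Nv; apply: Binf; exists 0%N, (fun=> 0).
  split=> [[]//|v Bv]; exists (fun=> 0); rewrite big_ord0.
  by apply: contrapT => /eqP v0; apply: Nv; exists v.
exists (`|v|^-1 *: v); first by rewrite -[_ *: _]addr0; exact: Bl.
by rewrite normrZ ger0_norm ?invr_ge0// mulVf// normr_eq0.
Qed.

(** Preimages in [B] of points near a limit point of [T @` B] form a Cauchy filter,
    because [T] is bounded below there. *)
Lemma closed_image (V W : normedModType K) (T : {linear V -> W})
    (c : K) (B : set V) :
  (forall F : set_system V, ProperFilter F -> cauchy F -> cvg F) ->
  (exists M, forall x, `|T x| <= M * `|x|) -> 0 < c ->
  (forall x, B x -> c * `|x| <= `|T x|) ->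
  linear_subspace B -> closed B -> closed (T @` B).
Proof.
move=> Vc [M0 /bound_gt0[M {M0} M0 TM]] c0 Tc [B0 Bl] /closed_normP Bcl.
apply/closed_normP => w wB.
pose G d := [set x | B x /\ `|w - T x| < d].
pose F := filter_from [set d : K | 0 < d] G.
have GF d : 0 < d -> F (G d) by move=> d0; exists d.
have FF : ProperFilter F.
  apply: filter_from_proper.
    apply: filter_from_filter; first by exists 1 => /=.
    move=> a b /= a0 b0; have [ab|ba] := real_leP (gtr0_real a0) (gtr0_real b0).
      exists a => // x [Bx xa]; split; split=> //; exact: lt_le_trans ab.
    exists b => // x [Bx xb]; split; split=> //; exact: lt_trans ba.
  by move=> d /= d0; have [_ [x Bx <-] xd] := wB _ d0; exists x.
have B_sub x y : B x -> B y -> B (x - y).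
  by move=> Bx By; rewrite addrC -scaleN1r; exact: Bl.
have GG d x y : G d x -> G d y -> c * `|x - y| < d + d.
  move=> [Bx xd] [By yd]; rewrite (le_lt_trans (Tc _ (B_sub _ _ Bx By)))//.
  by rewrite linearB /= (le_lt_trans (ler_distD w _ _))// ltrD// distrC.
have /cvg_ex[b Fb] : cvg F.
  apply: Vc; apply: cauchy_exP => e e0.
  have d0 : 0 < c * e / 2 by rewrite divr_gt0// mulr_gt0.
  have [_ [x Bx <-] xd] := wB _ d0; exists x.
  exists (c * e / 2) => // y Gy; rewrite -ball_normE /=.
  by rewrite -(ltr_pM2l c0) [ltRHS]splitr; exact: GG (conj Bx xd) Gy.
have Fball d : 0 < d -> F [set y | `|b - y| < d].
  by move=> d0; have := Fb _ (nbhsx_ballx b d d0); rewrite -ball_normE.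
have Bb : B b.
  apply: Bcl => d d0.
  have [y [[By _] yd]] := filter_ex (filterI (GF 1 ltr01) (Fball d d0)).
  by exists y.
exists b => //; apply/eqP; rewrite -subr_eq0 -normr_le0.
apply/ler_addgt0Pr => d d0; rewrite add0r.
have d2 : 0 < d / 2 by rewrite divr_gt0.
have dM : 0 < d / 2 / M by rewrite divr_gt0.
have [y [[By yw] yd]] := filter_ex (filterI (GF _ d2) (Fball _ dM)).
rewrite (le_trans (ler_distD (T y) _ _))// [leRHS]splitr lerD//.
  by rewrite -linearB (le_trans (TM _))// mulrC -ler_pdivlMr// ltW.
by rewrite distrC ltW.
Qed.

End NormedSubspaces.

(** * Lifting complemented subspaces through an operator *)

Section Lifting.
Context {K : numFieldType}.

(** With [S] an inverse of the restriction of [T] to [B] and [P] a projection onto a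
    complemented subspace [Z0] of [T @` B], the projection is [S \o P \o T]. It
    is bounded since [S] is, by [c^-1]. *)
Lemma complemented_lift (V W : normedModType K) (T : {linear V -> W})
    (c : K) (B : set V) :
  (forall F : set_system V, ProperFilter F -> cauchy F -> cvg F) ->
  (exists M, forall x, `|T x| <= M * `|x|) -> 0 < c ->
  (forall x, B x -> c * `|x| <= `|T x|) ->
  subspace B -> subprojective W ->
  exists Z, [/\ Z `<=` B, subspace Z & complemented Z].
Proof.
move=> Vc Tb c0 Tc [Bl Bcl Binf] Wsub.
have B_sub x y : B x -> B y -> B (x - y).
  by move=> Bx By; rewrite addrC -scaleN1r; exact: Bl.2.
have Tinj x : B x -> T x = 0 -> x = 0.
  move=> Bx Tx0; have := Tc _ Bx; rewrite Tx0 normr0 pmulr_rle0// normr_le0.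
  by move/eqP.
have [Z0 [Z0TB [Z0l Z0cl Z0inf] [P [Pb PP rangeP]]]] : exists Z,
    [/\ Z `<=` T @` B, subspace Z & complemented Z].
  apply: Wsub; split.
  - exact: linear_subspace_image.
  - exact: closed_image Tc _ _.
  - exact: infinite_dimensional_image.
have [MP MP0 PM] : exists2 M, 0 < M & forall x, `|P x| <= M * `|x|.
  by case: Pb => M; exact: bound_gt0.
have [M M0 TM] : exists2 M, 0 < M & forall x, `|T x| <= M * `|x|.
  by case: Tb => M'; exact: bound_gt0.
have Prange y : Z0 (P y) by rewrite -rangeP; exists y.
have Pfix y : Z0 y -> P y = y by rewrite -{1}rangeP => -[x _ <-].
have /choice[S SP] y : exists x, Z0 y -> B x /\ T x = y.
  have [Z0y|Z0y] := pselect (Z0 y); last by exists 0.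
  by have [x Bx <-] := Z0TB _ Z0y; exists x.
pose Q x := S (P (T x)).
have BQ x : B (Q x) by have [] := SP _ (Prange (T x)).
have TQ x : T (Q x) = P (T x) by have [] := SP _ (Prange (T x)).
have Teq x y : B x -> B y -> T x = T y -> x = y.
  move=> Bx By Txy; apply/eqP; rewrite -subr_eq0; apply/eqP.
  by apply: Tinj; [exact: B_sub|rewrite linearB Txy subrr].
have Ql : linear Q.
  move=> a x y; apply: Teq => //; first exact: Bl.2.
  by rewrite linearP !TQ !linearP.
pose G := GRing.isLinear.Build K V V *:%R Q Ql.
pose PQ : {linear V -> V} := HB.pack Q G.
pose Z := B `&` (T @^-1` Z0).
exists Z; split; first by move=> x [].
  split.
  - by apply: linear_subspaceI => //; exact: linear_subspace_preimage.
  - by apply: closedI => //; exact: closed_preimage_bounded M0 TM _.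
  - move=> /(finite_dimensional_image T) [n [v [vT vspan]]]; apply: Z0inf.
    exists n, v; split=> [i|y Zy]; first by have [x [_ ?] <-] := vT i.
    by apply: vspan; have [x Bx Txy] := Z0TB _ Zy; exists x => //; split=> //=; rewrite Txy.
have QZ x : Z (Q x) by split=> //=; rewrite TQ.
have Qfix x : Z x -> Q x = x.
  by move=> [Bx Zx]; apply: Teq => //; rewrite TQ Pfix.
exists PQ; split=> [|x|].
- exists (MP * M / c) => x /=.
  rewrite mulrAC ler_pdivlMr// mulrC (le_trans (Tc _ (BQ x)))// TQ.
  by rewrite (le_trans (PM _))// -mulrA ler_pM2l.
- by rewrite /= Qfix.
- by apply/seteqP; split=> [_ [x _ <-]|x Zx]; [exact: QZ|exists x => //=; exact: Qfix].
Qed.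

Lemma subprojective_embedding (V W : normedModType K) (T : {linear V -> W})
    (c : K) :
  (forall F : set_system V, ProperFilter F -> cauchy F -> cvg F) ->
  (exists M, forall x, `|T x| <= M * `|x|) -> 0 < c ->
  (forall x, c * `|x| <= `|T x|) -> subprojective W -> subprojective V.
Proof.
by move=> Vc Tb c0 Tc Wsub B Bs; apply: complemented_lift Tb c0 _ Bs Wsub.
Qed.

Lemma prod_norm_fst (X Y : normedModType K) (x : (X * Y)%type) : `|x.1| <= `|x|.
Proof. by rewrite [leRHS]/(Num.max _ _) comparable_le_max ?lexx// real_comparable. Qed.

Lemma prod_norm_snd (X Y : normedModType K) (x : (X * Y)%type) : `|x.2| <= `|x|.
Proof. by rewrite [leRHS]/(Num.max _ _) comparable_le_max ?lexx ?orbT// real_comparable. Qed.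

Lemma product_complete (X Y : completeNormedModType K)
    (F : set_system ((X * Y)%type : normedModType K)) :
  ProperFilter F -> cauchy F -> cvg F.
Proof.
move=> FF Fc.
have Fex (Z : completeNormedModType K) (p : {linear (X * Y)%type -> Z}) :
    (forall x, `|p x| <= `|x|) -> cvg (p @ F).
  move=> p1; apply: cauchy_cvg; apply: cauchy_exP => d d0.
  have /cauchy_ballP/(_ _ d0)[[A B] /= [FA FB] AB] := Fc.
  have [x Ax] := filter_ex FA; exists (p x).
  apply: filterS FB => y By; rewrite -ball_normE /= -linearB (le_lt_trans (p1 _))//.
  by have := AB (x, y) (conj Ax By); rewrite -ball_normE.
have /cvg_ex[l Fl] : cvg (fst @ F) by apply: Fex => x; exact: prod_norm_fst.
have /cvg_ex[m Fm] : cvg (snd @ F) by apply: Fex => x; exact: prod_norm_snd.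
apply/cvg_ex; exists (l, m).
move=> A /(cvg_pair Fl Fm) FA; rewrite /nbhs /=.
rewrite (_ : A = (fun x => (x.1, x.2)) @^-1` A); first exact: FA.
by apply/seteqP; split=> -[].
Qed.

End Lifting.

(** * Sequences with controlled coefficients *)

Section ClosedSpan.
Context {K : numFieldType}.

Lemma linear_subspace_closure (V : normedModType K) (A : set V) :
  linear_subspace A -> linear_subspace (closure A).
Proof.
move=> [A0 Al]; split; first exact: subset_closure.
move=> c x y /closure_normP Ax /closure_normP Ay; apply/closure_normP => d d0.
have c0 : 0 < `|c| + 1 by rewrite ltr_wpDl.
have d2 : 0 < d / 2 by rewrite divr_gt0.
have [x' Ax' xx'] := Ax _ (divr_gt0 d2 c0); have [y' Ay' yy'] := Ay _ d2.
exists (c *: x' + y'); first exact: Al.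
rewrite opprD addrACA -scalerBr (le_lt_trans (ler_normD _ _))// [ltRHS]splitr.
rewrite ler_ltD// normrZ (@le_trans _ _ ((`|c| + 1) * `|x - x'|))//.
  by rewrite ler_wpM2r// lerDl.
by rewrite mulrC -ler_pdivlMr// ltW.
Qed.

(** Used to pass from finite sums to their closure for both upper and lower
    norm bounds of an operator. *)
Lemma closure_le (V : normedModType K) (A : set V) (u v : V -> K) (M : K) :
  0 < M -> (forall x y, u x <= u y + M * `|x - y|) ->
  (forall x y, v y <= v x + M * `|x - y|) ->
  (forall x, A x -> u x <= v x) -> forall x, closure A x -> u x <= v x.
Proof.
move=> M0 uM vM uv x /closure_normP Ax; apply/ler_addgt0Pr => d d0.
have dM : 0 < d / 2 / M by rewrite !divr_gt0.
have [y Ay xy] := Ax _ dM.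
have Md : M * `|x - y| <= d / 2 by rewrite mulrC -ler_pdivlMr// ltW.
rewrite (le_trans (uM x y))// [d]splitr addrA lerD// (le_trans (uv _ Ay))//.
by rewrite (le_trans (vM x y))// lerD2l.
Qed.

Definition finite_sums (V : lmodType K) (z : nat -> V) : set V :=
  [set x | exists n (a : nat -> K), x = \sum_(i < n) a i *: z i].

Lemma finite_sums_widen (V : lmodType K) (z : nat -> V) (n m : nat)
    (a : nat -> K) : (n <= m)%N ->
  \sum_(i < n) a i *: z i =
  \sum_(i < m) (if (i < n)%N then a i else 0) *: z i.
Proof.
move=> nm; rewrite (big_ord_widen m (fun i => a i *: z i) nm) big_mkcond.
by apply: eq_bigr => i _; case: ifP => //; rewrite scale0r.
Qed.

Lemma linear_subspace_finite_sums (V : lmodType K) (z : nat -> V) :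
  linear_subspace (finite_sums z).
Proof.
split=> [|c _ _ [n [a ->]] [m [b ->]]].
  by exists 0%N, (fun=> 0); rewrite big_ord0.
rewrite (finite_sums_widen _ _ (leq_maxl n m)).
rewrite (finite_sums_widen _ _ (leq_maxr n m)).
rewrite scaler_sumr -big_split /=.
pose d i := c * (if (i < n)%N then a i else 0) + (if (i < m)%N then b i else 0).
exists (maxn n m), d; apply: eq_bigr => i _.
by rewrite scalerA -scalerDl.
Qed.

(** This makes the [z k] linearly independent, and lets perturbations of [z k] of size
    [4 ^- k] change a combination by a fixed fraction of its norm at most. *)
Definition coordinate_bounded (V : normedModType K) (z : nat -> V) : Prop :=
  forall n (a : nat -> K) k, (k < n)%N ->
    `|a k| <= 2 ^+ k * `|\sum_(i < n) a i *: z i|.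

Lemma subspace_closed_span (V : normedModType K) (z : nat -> V) :
  coordinate_bounded z -> subspace (closure (finite_sums z)).
Proof.
move=> zb; split; first exact: linear_subspace_closure (linear_subspace_finite_sums z).
  exact: closed_closure.
apply: (@infinite_dimensional_free _ _ _ z) => [k|n a az i ni].
  apply: subset_closure; exists k.+1, (fun i => if i == k then 1 else 0).
  rewrite big_ord_recr /= eqxx scale1r big1 ?add0r// => i _.
  by rewrite ltn_eqF ?ltn_ord// scale0r.
by have := zb n a i ni; rewrite az normr0 mulr0 normr_le0 => /eqP.
Qed.

Lemma closed_span_sub (V : normedModType K) (z : nat -> V) (A : set V) :
  subspace A -> (forall k, A (z k)) -> closure (finite_sums z) `<=` A.
Proof.
move=> [Al Acl _] Az x /closure_normP zx; apply: (closed_normP A).1 => // d d0.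
have [_ [n [a ->]] xy] := zx _ d0.
by exists (\sum_(i < n) a i *: z i) => //; apply: linear_subspace_sum.
Qed.

End ClosedSpan.

Section Selection.
Context {K : numFieldType} (Knorming : norming_functionals K).

(** The relation [D] lets the requirement on the next vector depend on those chosen
    before. With [f k] norming [z k] and vanishing on all later vectors, [f k]
    applied to [x = \sum_i a i *: z i] expresses [a k] through [f k x] and the
    earlier coefficients, so that [`|a k|] is at most
    [`|x| * (1 + \sum_(i < k) 2 ^+ i)], which is [2 ^+ k * `|x|]. *)
Lemma triangular_sequence (V : normedModType K) (A : set V)
    (D : seq V -> V -> Prop) :
  subspace A ->
  (forall s B, B `<=` A -> subspace B -> exists z, [/\ B z, `|z| = 1 & D s z]) ->
  exists z : nat -> V,
    (forall k, [/\ A (z k), `|z k| = 1 & D (mkseq z k) (z k)]) /\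
    coordinate_bounded z.
Proof.
move=> As AD.
have /choice[f /all_and2[f1 fz]] := Knorming (V := V).
pose B (s : seq V) := A `&` [set x | forall y, y \in s -> f y x = 0].
have Bs s : subspace (B s).
  elim: s => [|y s IH].
    by rewrite /B (_ : [set _ | _] = setT) ?setIT//; apply/seteqP; split.
  rewrite (_ : B _ = B s `&` [set x | f y x = 0]); first exact: subspaceI_kernel.
  apply/seteqP; split=> [x [Ax xs]|x [[Ax xs] /= yx]].
    split=> /=; last by apply: xs; rewrite inE eqxx.
    by split=> // t ts; apply: xs; rewrite inE ts orbT.
  by split=> // t; rewrite inE => /orP[/eqP ->//|]; exact: xs.
have /choice[nxt nxtP] s : exists z, [/\ B s z, `|z| = 1 & D s z].
  by apply: AD => // x [].
pose S := fix S k := if k is k'.+1 then rcons (S k') (nxt (S k')) else [::].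
pose z k := nxt (S k).
have SE k : S k = mkseq z k by elim: k => //= k IH; rewrite mkseqS -IH.
have zP k : [/\ B (mkseq z k) (z k), `|z k| = 1 & D (mkseq z k) (z k)].
  by rewrite -SE; exact: nxtP.
exists z; split=> [k|n a k]; first by have [[]] := zP k.
set x := \sum_(i < n) _.
have fzz i j : (i < j)%N -> f (z i) (z j) = 0.
  by move=> ij; have [[_ /= ->]] := zP j => //; apply: map_f; rewrite mem_iota.
elim/ltn_ind: k => k IH kn.
have fx : a k = f (z k) x - \sum_(i < k) a i * f (z k) (z i).
  apply/eqP; rewrite eq_sym subr_eq addrC; apply/eqP.
  pose G i := a i * f (z k) (z i).
  transitivity (\sum_(i < k.+1) G i).
    rewrite (big_ord_widen n G kn) big_mkcond /x linear_sum /=.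
    apply: eq_bigr => i _; rewrite linearZ /=; case: ifPn => //.
    by rewrite ltnS -ltnNge => /fzz ->; rewrite mulr0.
  by rewrite big_ord_recr /= /G fz; have [_ -> _] := zP k; rewrite mulr1.
have sum2 : 2 ^+ k = 1 + \sum_(i < k) 2 ^+ i :> K.
  elim: (k) => [|m IHm]; first by rewrite big_ord0 addr0.
  by rewrite big_ord_recr /= addrA -IHm exprS mulr_natl mulr2n.
rewrite fx (le_trans (ler_normB _ _))// sum2 mulrDl mul1r lerD//.
rewrite mulr_suml (le_trans (ler_norm_sum _ _ _))//; apply: ler_sum => i _.
rewrite normrM (@le_trans _ _ (`|a i| * 1))//.
  by rewrite ler_wpM2l// (le_trans (f1 _ _))//; have [_ -> _] := zP i.
by rewrite mulr1; apply: IH => //; exact: ltn_trans (ltn_ord i) kn.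
Qed.

Definition bounded_below_on (V W : normedModType K) (T : V -> W) (B : set V) :=
  exists2 c : K, 0 < c & forall x, B x -> c * `|x| <= `|T x|.

Lemma geometric_sum_le (e : K) n : 0 <= e ->
  \sum_(i < n) 2 ^+ i * (e / 2 / 4 ^+ i) <= e.
Proof.
move=> e0; apply: (@le_trans _ _ (e * (1 - 2^-1 ^+ n))); last first.
  by rewrite ler_piMr// gerBl exprn_ge0// invr_ge0.
elim: n => [|n IH]; first by rewrite big_ord0 subrr mulr0.
rewrite big_ord_recr /= -lerBrDr (le_trans IH)// le_eqVlt; apply/orP; left; apply/eqP.
have -> : 4 ^+ n = 2 ^+ n * 2 ^+ n :> K by rewrite -exprMn -natrM.
rewrite exprS !exprVn; field.
by rewrite expf_neq0// pnatr_eq0.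
Qed.

Lemma small_vector (V W : normedModType K) (T : {linear V -> W}) (B : set V)
    (d : K) :
  linear_subspace B -> ~ bounded_below_on T B -> 0 < d ->
  exists z, [/\ B z, `|z| = 1 & `|T z| <= d].
Proof.
move=> [B0 Bl] Tnb d0.
have [x [Bx Tx]] : exists x, B x /\ `|T x| < d * `|x|.
  apply: contrapT => Nx; apply: Tnb; exists d => // x Bx.
  rewrite real_leNgt ?ger0_real ?mulr_ge0 ?(ltW d0)//.
  by apply/negP => Tx; apply: Nx; exists x.
have x0 : 0 < `|x|.
  rewrite normr_gt0; apply: contraTneq Tx => ->.
  by rewrite linear0 !normr0 mulr0 ltxx.
have xi : 0 <= `|x|^-1 by rewrite invr_ge0.
exists (`|x|^-1 *: x); split.
- by rewrite -[_ *: _]addr0; exact: Bl.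
- by rewrite normrZ (ger0_norm xi) mulVf// gt_eqF.
- rewrite linearZ normrZ /= (ger0_norm xi).
  by rewrite ler_pdivrMl// mulrC ltW.
Qed.

(** If [T] is bounded below on no subspace, a unit vector on which [T] is tiny can be
    found in every subspace. On the closed span of a triangular sequence of such
    vectors the norm of [T] is at most the sum of the coefficient bounds
    [2 ^+ k] times the norms of [T (z k)]. *)
Lemma bounded_below_or_small (V W : normedModType K) (T : {linear V -> W})
    (A : set V) :
  (exists M, forall x, `|T x| <= M * `|x|) ->
  (exists B, [/\ B `<=` A, subspace B & bounded_below_on T B]) \/
  (forall B (d : K), B `<=` A -> subspace B -> 0 < d ->
    exists C, [/\ C `<=` B, subspace C & forall x, C x -> `|T x| <= d * `|x|]).
Proof.
move=> [M0 /bound_gt0[M {M0} M0 TM]].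
have [|Tn] := pselect (exists B, [/\ B `<=` A, subspace B & bounded_below_on T B]).
  by left.
right=> B d BA Bs d0.
pose D (s : seq V) z := `|T z| <= d / 2 / 4 ^+ size s.
have [|z [zP zb]] := triangular_sequence (D := D) Bs.
  move=> s C CB Cs; apply: small_vector; first by have [] := Cs.
    by move=> TC; apply: Tn; exists C; split=> //; exact: subset_trans BA.
  by rewrite !divr_gt0// exprn_gt0.
exists (closure (finite_sums z)); split.
- by apply: closed_span_sub => // k; have [] := zP k.
- exact: subspace_closed_span.
- apply: (@closure_le _ _ _ _ _ (M + d)); first exact: addr_gt0.
  + move=> x y; rewrite -[x in T x](subrK y) linearD.
    rewrite (le_trans (ler_normD _ _))// addrC lerD2l (le_trans (TM _))//.
    by rewrite ler_wpM2r// lerDl ltW.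
  + move=> x y; rewrite -[y in leLHS](subrK x) (le_trans (ler_wpM2l (ltW d0) (ler_normD _ _)))//.
    by rewrite mulrDr addrC lerD2l distrC ler_wpM2r// lerDr ltW.
  + move=> _ [n [a ->]]; set x := \sum_(i < n) _.
    rewrite {1}/x linear_sum (le_trans (ler_norm_sum _ _ _))//.
    rewrite (@le_trans _ _ (\sum_(i < n) 2 ^+ i * (d / 2 / 4 ^+ i) * `|x|))//.
      apply: ler_sum => i _; rewrite linearZ normrZ /= mulrAC.
      apply: ler_pM => //; first by exact: zb.
      by have [_ _] := zP i; rewrite /D size_mkseq.
    by rewrite -mulr_suml ler_wpM2r// geometric_sum_le// ltW.
Qed.

End Selection.

(** * The sum of a sequence of spaces along a basis *)

Section BanachSum.
Context {K : numFieldType} {E : completeNormedModType K} {e : nat -> E}.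
Variables (he : unconditional1_basis e) (X : nat -> completeNormedModType K).
Local Notation S := (banach_sum he X).
Implicit Types x y z : S.

Definition bsum_coord n x : X n := x n.

Fact bsum_coord_linear n : linear (bsum_coord n).
Proof. by []. Qed.

HB.instance Definition _ n :=
  GRing.isLinear.Build K S (X n) *:%R (bsum_coord n) (bsum_coord_linear n).

Lemma basis_norm_gt0 n : 0 < `|e n|.
Proof. by rewrite normr_gt0 (basis_neq0 he). Qed.

Lemma bsum_coord_bounded n x : `|bsum_coord n x| <= `|e n|^-1 * `|x|.
Proof. by rewrite ler_pdivlMl ?basis_norm_gt0// mulrC bsum_coord_le. Qed.

Lemma bsum_restrict_cvg (D : pred nat) x :
  cvgn (series (fun n => `|if D n then x n else 0| *: e n)).
Proof.
apply: (expansion_dominated he) (expansion_cvg (bsum_absP x)) => n.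
by rewrite !normr_id; case: ifP => // _; rewrite normr0.
Qed.

Definition bsum_restrict (D : pred nat) x : S := 
  @BanachSum _ _ _ he X _ (@bsum_restrict_cvg D x).

Definition bsum_trunc N := bsum_restrict (fun n => n < N)%N.

Lemma bsum_trunc_abs N x :
  bsum_abs (bsum_trunc N x) = \sum_(n < N) `|x n| *: e n.
Proof.
apply: expansion_lim; apply: cvg_near_cst; exists N => // n /= Nn.
rewrite /series /= big_mkord (big_ord_widen n (fun n => `|x n| *: e n) Nn) [RHS]big_mkcond.
by apply: eq_bigr => i _; case: ifP => // _; rewrite normr0 scale0r.
Qed.

(** The norm of the tail of [x] is that of the tail of the basis expansion of
    [bsum_abs x]. *)
Lemma bsum_trunc_cvg x (d : K) : 0 < d ->
  exists N, forall m, (N <= m)%N -> `|x - bsum_trunc m x| <= d.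
Proof.
move=> d0; have := bsum_absP x; rewrite /basis_expansion => /cvgrPdist_le/(_ _ d0).
case=> N _ xN; exists N => m Nm; rewrite bsum_normE.
have := xN m Nm; rewrite /series /= big_mkord -bsum_trunc_abs.
suff -> : bsum_abs (x - bsum_trunc m x) = bsum_abs x - bsum_abs (bsum_trunc m x) by [].
apply: expansion_lim.
have := expansionB (bsum_absP x) (bsum_absP (bsum_trunc m x)).
rewrite (_ : (fun n => `|x n| - `|bsum_trunc m x n|) =
             (fun n => `|(x - bsum_trunc m x) n|)) //.
apply/funext => n /=.
by case: ifP => _; rewrite ?subrr ?normr0 ?subr0 ?subrr.
Qed.

Lemma bsum_trunc_le N x (d : K) : (forall n, (n < N)%N -> `|x n| <= d) ->
  `|bsum_trunc N x| <= d * \sum_(n < N) `|e n|.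
Proof.
move=> xd; rewrite bsum_normE bsum_trunc_abs mulr_sumr.
rewrite (le_trans (ler_norm_sum _ _ _))//; apply: ler_sum => n _.
by rewrite normrZ normr_id ler_wpM2r// xd.
Qed.

Lemma dfwith0_norm n (v : X n) m :
  `|dfwith (fun k => 0 : X k) n v m| = if m == n then `|v| else 0.
Proof.
have [->|mn] := eqVneq m n; first by rewrite dfwithin.
by rewrite dfwithout 1?eq_sym// normr0.
Qed.

Lemma bsum_summand_cvg n (v : X n) :
  cvgn (series (fun m => `|dfwith (fun k => 0 : X k) n v m| *: e m)).
Proof.
under eq_fun do rewrite dfwith0_norm.
exact: (expansion_cvg (@expansion_delta K E e `|v| n)).
Qed.

Definition bsum_summand n (v : X n) : S :=
  @BanachSum _ _ _ he X _ (@bsum_summand_cvg n v).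

Fact bsum_summand_linear n : linear (@bsum_summand n).
Proof.
move=> c v w; apply: bsum_ext => m /=.
have [->|mn] := eqVneq m n; first by rewrite !dfwithin.
by rewrite !dfwithout 1?eq_sym// scaler0 addr0.
Qed.

HB.instance Definition _ n :=
  GRing.isLinear.Build K (X n) S *:%R (@bsum_summand n) (@bsum_summand_linear n).

Lemma bsum_summand_norm n (v : X n) : `|bsum_summand v| = `|e n| * `|v|.
Proof.
rewrite bsum_normE -[`|v|]normr_id mulrC -normrZ; congr (`|_|).
apply: expansion_lim => /=; rewrite /basis_expansion.
under eq_fun do rewrite dfwith0_norm.
exact: (@expansion_delta K E e `|v| n).
Qed.

Lemma subprojective_summand n : subprojective S -> subprojective (X n).
Proof.
apply: (@subprojective_embedding _ _ _ (@bsum_summand n) `|e n|).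
- by move=> F; exact: cauchy_cvg.
- by exists `|e n| => v; rewrite bsum_summand_norm.
- exact: basis_norm_gt0.
- by move=> v; rewrite bsum_summand_norm.
Qed.

(** The coefficient sequence of [v] times fixed unit vectors [u n] gives an
    isometric copy of [E] in the sum. *)
Lemma subprojective_scalars :
  (forall n, infinite_dimensional (X n)) -> subprojective S -> subprojective E.
Proof.
move=> Xinf.
have unit_vectors n : exists v : X n, `|v| = 1.
  by have [//|v _ v1] := unit_vector _ (Xinf n); exists v.
pose u n : X n := sval (cid (unit_vectors n)).
have u1 n : `|u n| = 1 := svalP (cid (unit_vectors n)).
have /choice[a aP] := expansion_exists he.
have J_cvg v : cvgn (series (fun n => `|a v n *: u n| *: e n)).
  apply: (expansion_dominated he) (expansion_cvg (aP v)) => n.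
  by rewrite normr_id normrZ u1 mulr1.
pose J v : S := @BanachSum _ _ _ he X _ (J_cvg v).
have J_linear : linear J.
  move=> c v w; apply: bsum_ext => n /=.
  have -> : a (c *: v + w) = fun n => c * a v n + a w n.
    exact: (expansion_inj he (aP _) (expansionD (expansionZ (c := c) (aP v)) (aP w))).
  by rewrite scalerDl scalerA.
pose G := GRing.isLinear.Build K E S *:%R J J_linear.
pose JL : {linear E -> S} := HB.pack J G.
have J_norm v : `|JL v| = `|v|.
  rewrite bsum_normE; apply: le_anti; apply/andP; split.
    apply: (expansion_le he (bsum_absP (J v)) (aP v)) => n /=.
    by rewrite normr_id normrZ u1 mulr1.
  apply: (expansion_le he (aP v) (bsum_absP (J v))) => n /=.
  by rewrite normr_id normrZ u1 mulr1.
apply: (@subprojective_embedding _ _ _ JL 1).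
- by move=> F; exact: cauchy_cvg.
- by exists 1 => v; rewrite J_norm mul1r.
- exact: ltr01.
- by move=> v; rewrite J_norm mul1r.
Qed.

End BanachSum.

(** * The gliding hump *)

Section GlidingHump.
Context {K : numFieldType} {E : completeNormedModType K} {e : nat -> E}.
Variables (he : unconditional1_basis e) (X : nat -> completeNormedModType K).
Local Notation S := (banach_sum he X).
Implicit Types (x y : S) (A B C : set S).
Hypothesis Knorming : norming_functionals K.

(** By [bounded_below_or_small], this is the case where no coordinate map is bounded
    below on a subspace of [A]. *)
Definition small_on_coordinates A := forall n B (d : K),
  B `<=` A -> subspace B -> 0 < d ->
  exists C, [/\ C `<=` B, subspace C & forall x, C x -> `|x n| <= d * `|x|].

Lemma small_on_first_coordinates A N B (d : K) : small_on_coordinates A ->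
  B `<=` A -> subspace B -> 0 < d ->
  exists C, [/\ C `<=` B, subspace C &
    forall x, C x -> forall n, (n < N)%N -> `|x n| <= d * `|x|].
Proof.
move=> As BA Bs d0; elim: N => [|N [C [CB Cs Cd]]]; first by exists B; split=> // x _ n.
have [C' [C'C C's C'd]] := As N C d (subset_trans CB BA) Cs d0.
exists C'; split=> // [|x C'x n]; first exact: subset_trans CB.
rewrite ltnS leq_eqVlt => /orP[/eqP ->|nN]; first exact: C'd.
by apply: Cd => //; exact: C'C.
Qed.

Lemma small_truncation A N B (d : K) : small_on_coordinates A ->
  B `<=` A -> subspace B -> 0 < d ->
  exists z, [/\ B z, `|z| = 1 & `|bsum_trunc N z| <= d].
Proof.
move=> As BA Bs d0.
pose s : K := \sum_(n < N) `|e n|.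
have s0 : 0 < s + 1 by rewrite ltr_wpDl// sumr_ge0.
have [C [CB Cs Cd]] := small_on_first_coordinates N As BA Bs (divr_gt0 d0 s0).
have [z Cz z1] : exists2 z, C z & `|z| = 1 by case: Cs => Cl _; exact: unit_vector.
exists z; split=> //; first exact: CB.
rewrite (@le_trans _ _ (d / (s + 1) * s))//.
  by apply: bsum_trunc_le => n nN; have := Cd z Cz n nN; rewrite z1 mulr1.
by rewrite mulrAC ler_pdivrMr// ler_pM2l// lerDl.
Qed.

Lemma bsum_block_dist (N M : nat) (x : S) : (N <= M)%N ->
  `|x - bsum_restrict (fun n => (N <= n < M)%N) x| <=
  `|bsum_trunc N x| + `|x - bsum_trunc M x|.
Proof.
move=> NM; rewrite (le_trans _ (ler_normD _ _))//.
rewrite le_eqVlt; apply/orP; left; apply/eqP; congr (`|_|).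
apply: bsum_ext => n /=; case: (ltnP n N) => [nN|Nn] /=.
  by rewrite (leq_trans nN NM) subrr addr0 subr0.
by rewrite add0r.
Qed.

(** [N k] is chosen large enough for the tails of all earlier vectors to be small;
    [z k] is then chosen small on the first [N k] coordinates. Nothing prevents
    a block from being empty. *)
Lemma gliding_hump A : subspace A -> small_on_coordinates A ->
  forall d : nat -> K, (forall k, 0 < d k) ->
  exists (z : nat -> S) (N : nat -> nat),
  [/\ forall k, A (z k), coordinate_bounded z, {homo N : i j / (i <= j)%N} &
    forall k, `|z k - bsum_restrict (fun n => (N k <= n < N k.+1)%N) (z k)|
      <= d k + d k].
Proof.
move=> As Asmall d d0.
have /choice[t tP] k : exists t : S -> nat, forall x m, (t x <= m)%N ->
    `|x - bsum_trunc m x| <= d k.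
  by have [t tP] := choice (fun x => bsum_trunc_cvg x (d0 k)); exists t.
pose cut (s : seq S) := \max_(i < size s) t i (nth 0%R s i).
pose D (s : seq S) (z : S) : Prop := `|bsum_trunc (cut s) z| <= d (size s).
have [|z [zP zb]] := triangular_sequence Knorming (D := D) As.
  by move=> s B BA Bs; exact: small_truncation Asmall BA Bs (d0 _).
pose N k := \max_(i < k) t i (z i).
have NE k : cut (mkseq z k) = N k.
  rewrite /cut size_mkseq; apply: eq_bigr => i _; by rewrite nth_mkseq.
have NS k : N k.+1 = maxn (N k) (t k (z k)) by rewrite /N big_ord_recr.
have Nhomo : {homo N : i j / (i <= j)%N}.
  by apply: homo_leq => // [i j k|k]; [exact: leq_trans|rewrite NS leq_maxl].
exists z, N; split=> // k; first by have [] := zP k.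
rewrite (le_trans (bsum_block_dist _ (Nhomo _ _ (leqnSn k))))// lerD//.
  by have [_ _] := zP k; rewrite /D NE size_mkseq.
by apply: tP; rewrite NS leq_maxr.
Qed.

Lemma block_unique (N : nat -> nat) n i j : {homo N : i j / (i <= j)%N} ->
  (N i <= n < N i.+1)%N -> (N j <= n < N j.+1)%N -> i = j.
Proof.
move=> Nh; wlog ij : i j / (i <= j)%N => [H|] Hi Hj.
  by have [ij|/ltnW ji] := leqP i j; [exact: H|apply/esym; exact: H].
apply/eqP; rewrite eqn_leq ij leqNgt; apply/negP => /Nh Nij.
by move: Hi Hj => /andP[_ ni] /andP[Nj _]; rewrite ltnNge (leq_trans Nij Nj) in ni.
Qed.

Section CoordinateFunctionals.
Variable f : forall n, {scalar (X n)}.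
Hypothesis f1 : forall n v, `|f n v| <= `|v|.

Lemma functional_cvg x : cvgn (series (fun n => f n (x n) *: e n)).
Proof.
apply: (expansion_dominated he) (expansion_cvg (bsum_absP x)) => n.
by rewrite normr_id.
Qed.

Definition bsum_functional x : E := limn (series (fun n => f n (x n) *: e n)).

Lemma bsum_functionalP x : basis_expansion e (fun n => f n (x n)) (bsum_functional x).
Proof. exact: functional_cvg. Qed.
Arguments bsum_functionalP : clear implicits.

Fact bsum_functional_linear : linear bsum_functional.
Proof.
move=> c x y; apply: expansion_lim.
have := expansionD (expansionZ (c := c) (bsum_functionalP x)) (bsum_functionalP y).
by congr (basis_expansion _ _ _); apply/funext => n /=; rewrite linearP.
Qed.

Lemma bsum_functional_bounded x : `|bsum_functional x| <= `|x|.
Proof.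
apply: (expansion_le he (bsum_functionalP x) (bsum_absP x)) => n.
by rewrite normr_id.
Qed.

(** Here 1-unconditionality enters: the norm of an expansion depends only on the
    moduli of its coefficients. *)
Lemma bsum_functional_isometric x : (forall n, `|f n (x n)| = `|x n|) ->
  `|bsum_functional x| = `|x|.
Proof.
move=> fx; apply: le_anti; rewrite bsum_functional_bounded/=.
apply: (expansion_le he (bsum_absP x) (bsum_functionalP x)) => n.
by rewrite normr_id fx.
Qed.

End CoordinateFunctionals.

(** The operator [Q] applies to the [n]-th coordinate a functional norming the
    coordinate of the one [z k] whose block contains [n]. It is isometric on
    combinations of the blocks [w k], and the [w k] are so close to the [z k] that
    passing from one to the other changes [x] and [Q x] by at most a quarter of
    the norm of [x] each. *)
Lemma complemented_of_small_on_coordinates A : subprojective E ->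
  subspace A -> small_on_coordinates A ->
  exists Z, [/\ Z `<=` A, subspace Z & complemented Z].
Proof.
move=> Esub As Asmall.
(* twice d k, the distance of z k to its block, sums against 2 ^+ k to 1/4 *)
pose d k : K := 4^-1 / 2 / 4 ^+ k / 2.
have d0 k : 0 < d k by rewrite !divr_gt0// ?invr_gt0 ?exprn_gt0.
have [z [N [Az zb Nhomo zN]]] := gliding_hump As Asmall d0.
pose w k := bsum_restrict (fun n => (N k <= n < N k.+1)%N) (z k).
have fex n : exists f : {scalar (X n)}, (forall v, `|f v| <= `|v|) /\
    forall k, (N k <= n < N k.+1)%N -> f (z k n) = `|z k n|.
  have [[k kn]|Nk] := pselect (exists k, (N k <= n < N k.+1)%N).
    have [f [f1 fz]] := Knorming (z k n); exists f; split=> // j jn.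
    by rewrite (block_unique Nhomo jn kn).
  have [f [f1 _]] := Knorming (0 : X n); exists f; split=> // j jn.
  by exfalso; apply: Nk; exists j.
pose f n := sval (cid (fex n)).
have f1 n v : `|f n v| <= `|v| by have [] := svalP (cid (fex n)).
have fz k n : (N k <= n < N k.+1)%N -> f n (z k n) = `|z k n|.
  by move=> kn; have [_] := svalP (cid (fex n)); apply.
pose G := GRing.isLinear.Build K S E *:%R _ (bsum_functional_linear f1).
pose Q : {linear S -> E} := HB.pack (bsum_functional f) G.
have Qw n (a : nat -> K) : `|Q (\sum_(i < n) a i *: w i)| = `|\sum_(i < n) a i *: w i|.
  set x := \sum_(i < n) _; apply: bsum_functional_isometric => // m.
  have -> : x m =
      \sum_(i < n) a i *: (if (N i <= m < N i.+1)%N then z i m else 0).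
    by rewrite -[LHS]/(bsum_coord m x) linear_sum; apply: eq_bigr => i _; rewrite linearZ.
  have [[k km]|Nk] := pselect (exists k : 'I_n, (N k <= m < N k.+1)%N).
    rewrite (bigD1 k) //= km big1 ?addr0.
      by rewrite linearZ /= fz// normrM normr_id normrZ.
    move=> i ik; case: ifPn => im; last by rewrite scaler0.
    by rewrite (val_inj (block_unique Nhomo im km)) eqxx in ik.
  rewrite big1 ?linear0 ?normr0// => i _.
  case: ifPn => im; last by rewrite scaler0.
  by exfalso; apply: Nk; exists i.
have Qz x : closure (finite_sums z) x -> 2^-1 * `|x| <= `|Q x|.
  apply: (@closure_le _ _ _ (fun x => 2^-1 * `|x|) (fun x => `|Q x|) 1 ltr01).
  - move=> {}x y; rewrite mul1r -[x in leLHS](subrK y).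
    rewrite (le_trans (ler_wpM2l _ (ler_normD _ _)))// mulrDr addrC lerD2l.
    by rewrite ler_piMl// invf_le1// ler1n.
  - move=> {}x y; rewrite mul1r -[y in leLHS](subrK x) linearD.
    rewrite (le_trans (ler_normD _ _))// addrC lerD2l distrC.
    exact: bsum_functional_bounded.
  move=> _ [n [a ->]]; set x0 := \sum_(i < n) _.
  pose w0 := \sum_(i < n) a i *: w i.
  have xw : `|x0 - w0| <= 4^-1 * `|x0|.
    rewrite -sumrB (le_trans (ler_norm_sum _ _ _))//.
    rewrite (@le_trans _ _ (\sum_(i < n) 2 ^+ i * (4^-1 / 2 / 4 ^+ i) * `|x0|))//.
      apply: ler_sum => i _; rewrite -scalerBr normrZ mulrAC.
      apply: ler_pM => //; first by exact: zb.
      by rewrite (le_trans (zN i))// -splitr.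
    by rewrite -mulr_suml ler_wpM2r// geometric_sum_le// invr_ge0.
  have Qxw : `|Q (x0 - w0)| <= 4^-1 * `|x0|.
    exact: le_trans (bsum_functional_bounded _ _) xw.
  have half : (2^-1 : K) = 1 - 4^-1 - 4^-1 by field.
  rewrite half !mulrBl mul1r lerBlDr lerBlDr.
  rewrite -[x0 in leLHS](subrK w0) (le_trans (ler_normD _ _))// addrC lerD//.
  rewrite -(Qw n a : `|Q w0| = `|w0|) -[w0 in leLHS](subKr x0) linearB.
  by rewrite (le_trans (ler_normB _ _))// lerD2l.
have [Z [ZB Zs Zc]] : exists Z,
    [/\ Z `<=` closure (finite_sums z), subspace Z & complemented Z].
  apply: (@complemented_lift _ _ _ Q 2^-1) => //.
  - by move=> F; exact: cauchy_cvg.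
  - by exists 1 => x; rewrite mul1r; exact: bsum_functional_bounded.
  - exact: subspace_closed_span.
exists Z; split=> //; apply: subset_trans ZB _; exact: closed_span_sub.
Qed.

End GlidingHump.

(** * Stability of subprojectivity *)

Section Stability.
Context {K : numFieldType} (Knorming : norming_functionals K).

(** The norm on the product is the maximum, so where the first coordinate is at most
    half of the norm, the second coordinate carries all of it. *)
Lemma subprojective_prod (X Y : completeNormedModType K) :
  subprojective X -> subprojective Y -> subprojective (X * Y)%type.
Proof.
move=> Xsub Ysub A As.
have fst_b : exists M, forall x : (X * Y)%type, `|fst x| <= M * `|x|.
  by exists 1 => x; rewrite mul1r; exact: prod_norm_fst.
have snd_b : exists M, forall x : (X * Y)%type, `|snd x| <= M * `|x|.
  by exists 1 => x; rewrite mul1r; exact: prod_norm_snd.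
have [[B [BA Bs [c c0 Bc]]]|small] :=
    bounded_below_or_small Knorming (T := fst) A fst_b.
  have [Z [ZB Zs Zc]] :=
    complemented_lift (@product_complete _ X Y) fst_b c0 Bc Bs Xsub.
  by exists Z; split=> //; exact: subset_trans BA.
have h0 : 0 < 2^-1 :> K by rewrite invr_gt0.
have [B [BA Bs Bfst]] := small A 2^-1 (fun _ => id) As h0.
have Bsnd x : B x -> 1 * `|x| <= `|snd x|.
  move=> Bx; have := Bfst x Bx; rewrite mul1r.
  have [xn|xn] : `|x| = `|x.1| \/ `|x| = `|x.2|.
    rewrite [X in X = _ \/ X = _]/(Num.max _ _) /Num.max /Order.max.
    by case: ifP; [right|left].
  - rewrite -xn -subr_ge0 -{2}[`|x|]mul1r -mulrBl.
    have -> : 2^-1 - 1 = - 2^-1 :> K by field.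
    rewrite mulNr oppr_ge0 pmulr_rle0// => /le_trans; apply; exact: normr_ge0.
  - by rewrite xn.
have [Z [ZB Zs Zc]] :=
  complemented_lift (@product_complete _ X Y) snd_b ltr01 Bsnd Bs Ysub.
by exists Z; split=> //; exact: subset_trans BA.
Qed.

Lemma subprojective_prod_fst (X Y : completeNormedModType K) :
  subprojective (X * Y)%type -> subprojective X.
Proof.
pose T (x : X) : (X * Y)%type := (x, 0).
have T_linear : linear T by move=> c x y; rewrite /T; congr pair; rewrite /= scaler0 addr0.
pose G := GRing.isLinear.Build K X (X * Y)%type *:%R T T_linear.
pose TL : {linear X -> (X * Y)%type} := HB.pack T G.
apply: (@subprojective_embedding _ _ _ TL 1) => [F|||x].
- exact: cauchy_cvg.
- exists 1 => x; rewrite mul1r [leLHS]/(Num.max _ _) normr0 /Num.max /Order.max.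
  by case: ifP => //= _; exact: normr_ge0.
- exact: ltr01.
- by rewrite mul1r; exact: (prod_norm_fst (TL x)).
Qed.

Lemma subprojective_prod_snd (X Y : completeNormedModType K) :
  subprojective (X * Y)%type -> subprojective Y.
Proof.
pose T (y : Y) : (X * Y)%type := (0, y).
have T_linear : linear T by move=> c x y; rewrite /T; congr pair; rewrite /= scaler0 addr0.
pose G := GRing.isLinear.Build K Y (X * Y)%type *:%R T T_linear.
pose TL : {linear Y -> (X * Y)%type} := HB.pack T G.
apply: (@subprojective_embedding _ _ _ TL 1) => [F|||y].
- exact: cauchy_cvg.
- exists 1 => y; rewrite mul1r [leLHS]/(Num.max _ _) normr0 /Num.max /Order.max.
  by case: ifP => //= _; exact: normr_ge0.
- exact: ltr01.
- by rewrite mul1r; exact: (prod_norm_snd (TL y)).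
Qed.

Lemma subprojective_banach_sum (E : completeNormedModType K) (e : nat -> E)
    (he : unconditional1_basis e) (X : nat -> completeNormedModType K) :
  subprojective E -> (forall n, subprojective (X n)) ->
  subprojective (banach_sum he X).
Proof.
move=> Esub Xsub A As.
have coord_b n : exists M, forall x : banach_sum he X, `|bsum_coord n x| <= M * `|x|.
  by exists `|e n|^-1 => x; exact: bsum_coord_bounded.
have [[n [B [BA Bs [c c0 Bc]]]]|nB] := pselect (exists n B,
    [/\ B `<=` A, subspace B & bounded_below_on (@bsum_coord _ _ _ he X n) B]).
  have [|Z [ZB Zs Zc]] := complemented_lift _ (coord_b n) c0 Bc Bs (Xsub n).
    by move=> F; exact: cauchy_cvg.
  by exists Z; split=> //; exact: subset_trans BA.
apply: complemented_of_small_on_coordinates => // n.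
have [[B BP]|small] := bounded_below_or_small Knorming A (coord_b n).
  by exfalso; apply: nB; exists n, B.
exact: small.
Qed.

End Stability.

Theorem proposition2p1 (R : realType) (K : numFieldType)
    (hK : K = R :> numFieldType \/ K = R[i] :> numFieldType) :
  (forall X Y : completeNormedModType K,
      infinite_dimensional X -> infinite_dimensional Y ->
      (subprojective X /\ subprojective Y) <->
      subprojective (X * Y)%type) /\
  (forall (E : completeNormedModType K) (e : nat -> E)
      (he : unconditional1_basis e) (X : nat -> completeNormedModType K),
      (forall n, infinite_dimensional (X n)) ->
      (subprojective E /\ forall n, subprojective (X n)) <->
      subprojective (banach_sum he X)).
Proof.
have Knorming := RC_norming_functionals hK.
split=> [X Y _ _|E e he X Xinf]; split.
- by move=> [Xsub Ysub]; exact: subprojective_prod.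
- move=> XYsub; split; first exact: subprojective_prod_fst XYsub.
  exact: subprojective_prod_snd XYsub.
- by move=> [Esub Xsub]; exact: subprojective_banach_sum.
- move=> Ssub; split; first exact: subprojective_scalars Xinf Ssub.
  by move=> n; exact: subprojective_summand Ssub.
Qed.
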